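(* Let $S\in\{P,Q,D\}$ be any of the three BRST operators, $\overline S\in\{\overline P,\overline Q,\overline D\}$ the corresponding anti-BRST operator, $\widetilde S^l:=(-1)^l\,\overline S^l$ (where $l\in\mathbb Z$ denotes the respective degree) the corresponding sign-twisted anti-BRST operator, and let $\widetilde{\mathcal S}:=S\circ\widetilde S$. Then the sign-twisted anti-BRST operators $\widetilde S$ are cochain homotopies between $\widetilde{\mathcal S}$ and the zero map. Similarly, the BRST operators $S$ are chain homotopies between $\widetilde{\mathcal S}$ and the zero map. In particular, the maps $\widetilde{\mathcal S}$ are null homotopic for all $\widetilde{\mathcal S}\in\{\widetilde{\mathcal P},\widetilde{\mathcal Q},\widetilde{\mathcal D}\}$.
   Context: Setting. $(M,g)$ is a spacetime (smooth, connected, time-orientable Lorentzian manifold) with $g_{\mu\nu}=\eta_{\mu\nu}+\varkappa h_{\mu\nu}$, $\eta$ the Minkowski background metric, $h$ the graviton, $\varkappa$ the graviton coupling constant, $\Gamma^\rho{}_{\mu\nu}$ the Christoffel symbols of $g$. $\mathfrak g$ is the Lie algebra of the gauge group with structure constants $f^a{}_{bc}$ and coupling constant $\mathrm g$; $\zeta,\xi$ are gauge fixing parameters. Fields with bidegree (graviton-ghost degree, gauge ghost degree): $h_{\mu\nu}$, vielbein $e$, gauge boson $A^a_\mu$, Higgs/Goldstone vector $\Phi$, fermion vector $\Psi$, auxiliary (Lautrup–Nakanishi) fields $B^\rho$, $b_a$ of degree $(0,0)$; graviton-ghost $C_\rho$: $(1,0)$; graviton-antighost $\overline C^\rho$: $(-1,0)$;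 gauge ghost $c^a$: $(0,1)$; gauge antighost $\overline c_a$: $(0,-1)$. Parity is total degree mod 2. Spacetime indices are raised and lowered with metrics in ghost degree zero, gauge indices with $\delta_{ab}$. $\mathcal C_{\mathbf Q}$ is the superalgebra of functionals of particle fields, i.e. graded-symmetric polynomials in the dual of the space of fields; $\mathcal C_{\mathbf Q}^\bullet$ is graded by the degree respective to $S$: graviton-ghost degree for $P$, gauge ghost degree for $Q$, total ghost degree (the sum of both) for $D$. $\overline S^l$ denotes $\overline S$ acting in degree $l$ (not a power). The BRST cocomplex is $(\mathcal C_{\mathbf Q}^\bullet,S)$, with $S$ of degree $+1$, and the sign-twisted anti-BRST complex is $(\mathcal C_{\mathbf Q}^\bullet,\widetilde S)$, with $\widetilde S$ of degree $-1$; the cochain homotopies are meant for the former and the chain homotopies for the latter. All BRST and anti-BRST operators square to zero and mutually anticommute, so that $S$ commutes with $\widetilde S$. Diffeomorphism BRST operator $P$ (odd superderivation of bidegree $(1,0)$ with $P\partial_\mu=0$): $Ph_{\mu\nu}=\frac1\zeta\partial_\mu C_\nu+\frac1\zeta\partial_\nu C_\mu-2C_\rho\Gamma^\rho{}_{\mu\nu}$; $PC_\rho=\varkappa C^\sigma(\partial_\sigma C_\rho)$; $P\overline C^\rho=\frac1\zeta B^\rho$; $PB^\rho=0$; $P\eta_{\mu\nu}=0$; $P\delta_{ab}=0$; on all other fields $\varphi$ (i.e. $A,c,\overline c,b,\Phi,\Psi,e$) $P\varphi=\varkappa\mathcal L_C\varphi$ is $\varkappa$ times the Lie derivative along $C$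 (Kosmann's formula for spinors). Diffeomorphism anti-BRST operator $\overline P$ (bidegree $(-1,0)$): obtained from $P$ by replacing $C$ by $\overline C$, with the changes $\overline PC_\rho=-\frac1\zeta B_\rho+\varkappa\overline C^\sigma(\partial_\sigma C_\rho)+\varkappa(\partial_\rho\overline C^\sigma)C_\sigma$, $\overline P\,\overline C^\rho=\varkappa\overline C^\sigma(\partial_\sigma\overline C^\rho)$, $\overline PB^\rho=\varkappa\overline C^\sigma(\partial_\sigma B^\rho)-\varkappa(\partial_\sigma\overline C^\rho)B^\sigma$. Gauge BRST operator $Q$ (odd superderivation of bidegree $(0,1)$ with $Q\partial_\mu=0$): $QA^a_\mu=\frac1\xi\partial_\mu c^a+\mathrm gf^a{}_{bc}c^bA^c_\mu$; $Qc^a=\frac{\mathrm g}2f^a{}_{bc}c^bc^c$; $Q\overline c_a=\frac1\xi b_a$; $Qb_a=0$; $Q\delta_{ab}=0$; $Qh=QC=Q\overline C=QB=Q\eta=Q\Gamma=0$; $Q\Phi=\mathrm gc^a(\mathfrak H_a\cdot\Phi)$; $Q\Psi=\mathrm gc^a(\mathfrak S_a\cdot\Psi)$, with $\mathfrak H_a,\mathfrak S_a$ the infinitesimal gauge group actions. Gauge anti-BRST operator $\overline Q$ (bidegree $(0,-1)$): obtained from $Q$ by replacing $c$ by $\overline c$, with the changes $\overline Qc^a=-\frac1\xi b^a+\mathrm gf^a{}_{bc}\overline c^bc^c$, $\overline Q\,\overline c_a=\frac{\mathrm g}2f_{abc}\overline c^b\overline c^c$, $\overline Qb_a=\mathrm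 gf_{abc}\overline c^bb^c$. Total operators: $D=P+Q$, $\overline D=\overline P+\overline Q$. The maps $\widetilde{\mathcal P},\widetilde{\mathcal Q},\widetilde{\mathcal D}$ are $\widetilde{\mathcal S}$ for $S=P,Q,D$, respectively.
   Formalization: Since S commutes with S̃, S S̃ + S̃ S = 2 S∘S̃, so the claim is off by a factor 2; it is stated that S̃ (resp. S) is a cochain (resp. chain) homotopy between 2·(S∘S̃) and zero, and that S∘S̃ itself is null homotopic in both complexes. *)

(* Defs.v *)
From mathcomp Require Import all_boot all_order all_algebra.
From mathcomp Require Import reals complex.

Set Implicit Arguments.
Unset Strict Implicit.
Unset Printing Implicit Defensive.

Import Order.TTheory GRing.Theory Num.Theory.
Local Open Scope ring_scope.
Local Open Scope complex_scope.

(** * Complexes and homotopies *)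

(* A Z-graded module is an ambient module together with the predicates
   [hom l] "homogeneous of degree l". *)
Section Complexes.
Variables (K : nzRingType) (V : lmodType K) (hom : int -> V -> Prop).

Definition graded_map (k : int) (f : V -> V) : Prop :=
  linear f /\ forall l x, hom l x -> hom (l + k) (f x).

Definition is_complex (k : int) (d : V -> V) : Prop :=
  graded_map k d /\ forall x, d (d x) = 0.

Definition complex_map (d f : V -> V) : Prop :=
  graded_map 0 f /\ forall x, f (d x) = d (f x).

(* [h] is a homotopy between the endomorphisms [f] and [g] of the complex
   (V, d), whose differential has degree k: f - g = d h + h d. *)
Record is_homotopy (k : int) (d h f g : V -> V) : Prop := IsHomotopy {
  homotopy_complex : is_complex k d;
  homotopy_source : complex_map d f;
  homotopy_target : complex_map d g;
  homotopy_degree : graded_map (- k) h;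
  homotopyE : forall x, f x - g x = d (h x) + h (d x) }.

Definition cochain_homotopy := is_homotopy 1.
Definition chain_homotopy := is_homotopy (-1).

Definition cochain_null_homotopic (d f : V -> V) : Prop :=
  exists h, cochain_homotopy d h f (fun=> 0).
Definition chain_null_homotopic (d f : V -> V) : Prop :=
  exists h, chain_homotopy d h f (fun=> 0).

End Complexes.

(** * Bigraded superalgebras *)

Definition bidegree : Type := int * int.
Definition total_degree (p : bidegree) : int := p.1 + p.2.

(* The decomposition of the algebra into its components of bidegree p is given
   by the projections [component p]; [supp x] lists finitely many bidegrees that
   suffice to recover x.  Parity is total degree mod 2. *)
Record superalgebra (K : fieldType) (C : algType K) := Superalgebra {
  component : bidegree -> C -> C;
  supp : C -> seq bidegree;
  component_linear : forall p, linear (component p);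
  supp_uniq : forall x, uniq (supp x);
  component_sum : forall x, x = \sum_(p <- supp x) component p x;
  component_component : forall p q x,
    component p (component q x) = if p == q then component q x else 0;
  component_one : component (0, 0) 1 = 1;
  component_mul : forall p q x y, component p x = x -> component q y = y ->
    component (p.1 + q.1, p.2 + q.2) (x * y) = x * y;
  supercomm : forall p q x y, component p x = x -> component q y = y ->
    x * y = (-1) ^ (total_degree p * total_degree q) *: (y * x) }.

Section Superalgebra.
Variables (K : fieldType) (C : algType K) (G : superalgebra C).

Definition bihom (p : bidegree) (x : C) : Prop := component G p x = x.

(* Graded superderivations, acting from the left. *)
Record superderivation (r : bidegree) (d : C -> C) : Prop := Superderivation {
  sder_linear : linear d;
  sder_bideg : forall p x, bihom p x -> bihom (p.1 + r.1, p.2 + r.2) (d x);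
  sder_mul : forall p x y, bihom p x ->
    d (x * y) = d x * y
      + (-1) ^ (total_degree r * total_degree p) *: (x * d y) }.

(* Regrading along a degree function [deg] of the bidegree. *)
Definition homog (deg : bidegree -> int) (l : int) (x : C) : Prop :=
  forall p, component G p x != 0 -> deg p = l.

(* The operator that acts as (-1)^l d in degree l; see [sign_twistE]. *)
Definition sign_twist (deg : bidegree -> int) (d : C -> C) (x : C) : C :=
  \sum_(p <- supp G x) (-1) ^ deg p *: d (component G p x).

Lemma sign_twistE (deg : bidegree -> int) (d : C -> C) (l : int) (x : C) :
  linear d -> homog deg l x -> sign_twist deg d x = (-1) ^ l *: d x.
Proof.
move=> lin_d hx.
have d0 : d 0 = 0.
  have := lin_d (-1) 0 0; rewrite scaleN1r oppr0 addr0 => ->.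
  by rewrite scaleN1r addNr.
have dD y z : d (y + z) = d y + d z by have := lin_d 1 y z; rewrite !scale1r.
rewrite {2}(component_sum G x) (big_morph d dD d0) scaler_sumr.
apply: eq_bigr => p _; have [->|nz] := eqVneq (component G p x) 0.
  by rewrite d0 !scaler0.
by rewrite (hx p nz).
Qed.

End Superalgebra.

(** * Data of the gravity-gauge theory *)

(* [D.+1] is the spacetime dimension, index 0 being time. *)
Definition minkowski (K : nzRingType) (D : nat) (mu nu : 'I_D.+1) : K :=
  if mu == nu then (if mu == 0 then 1 else -1) else 0.
Arguments minkowski : clear implicits.

Record theory (R : realType) := Theory {
  dim : nat;
  ngauge : nat;
  nhiggs : nat;
  nfermion : nat;
  varkappa : R;
  gcoupling : R;
  zeta : R;
  xi : R;
  fstruct : 'I_ngauge -> 'I_ngauge -> 'I_ngauge -> R; (* f^a_{bc} *)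
  higgs_rep : 'I_ngauge -> 'M[R[i]]_nhiggs;
  fermion_rep : 'I_ngauge -> 'M[R[i]]_nfermion;
  gamma : 'I_dim.+1 -> 'M[R[i]]_nfermion; (* gamma^a on the fermion vector *)
  zeta_neq0 : zeta != 0;
  xi_neq0 : xi != 0;
  fstruct_anti : forall a b c, fstruct a b c = - fstruct a c b;
  fstruct_jacobi : forall a b c d, \sum_e (fstruct a b e * fstruct e c d
    + fstruct a c e * fstruct e d b + fstruct a d e * fstruct e b c) = 0;
  higgs_bracket : forall b c,
    higgs_rep b *m higgs_rep c - higgs_rep c *m higgs_rep b
    = \sum_a (fstruct a b c)%:C *: higgs_rep a;
  fermion_bracket : forall b c,
    fermion_rep b *m fermion_rep c - fermion_rep c *m fermion_rep b
    = \sum_a (fstruct a b c)%:C *: fermion_rep a;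
  clifford : forall a b,
    gamma a *m gamma b + gamma b *m gamma a = (2 * minkowski R[i] dim a b)%:M;
  (* The gauge action may depend on chirality, hence commutes only with the
     even part of the Clifford algebra. *)
  fermion_spin_comm : forall a b c,
    fermion_rep a *m (gamma b *m gamma c)
    = (gamma b *m gamma c) *m fermion_rep a }.

(** * The superalgebra of functionals of the particle fields *)

(* Coordinate functionals of the fields: the jet coordinates are the iterated
   images under the [pd mu] of the functionals below.  Since [pd mu] acts on
   functionals, "S d_mu = 0" becomes the commutation of S with [pd mu]. *)
Record particle_fields (R : realType) (T : theory R) (C : algType R[i])
    (G : superalgebra C) := ParticleFields {
  pd : 'I_(dim T).+1 -> C -> C;
  fh : 'I_(dim T).+1 -> 'I_(dim T).+1 -> C;   (* h_{mu nu} *)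
  fginv : 'I_(dim T).+1 -> 'I_(dim T).+1 -> C; (* g^{mu nu} *)
  fe : 'I_(dim T).+1 -> 'I_(dim T).+1 -> C;   (* e^a_mu, as [fe a mu] *)
  feinv : 'I_(dim T).+1 -> 'I_(dim T).+1 -> C; (* e_a^mu, as [feinv a mu] *)
  fA : 'I_(ngauge T) -> 'I_(dim T).+1 -> C;   (* A^a_mu *)
  fPhi : 'I_(nhiggs T) -> C;
  fPsi : 'I_(nfermion T) -> C;
  fB : 'I_(dim T).+1 -> C;                    (* B^rho *)
  fb : 'I_(ngauge T) -> C;                    (* b_a *)
  fC : 'I_(dim T).+1 -> C;                    (* C_rho, lower index *)
  fCbar : 'I_(dim T).+1 -> C;                 (* Cbar^rho, upper index *)
  fc : 'I_(ngauge T) -> C;                    (* c^a *)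
  fcbar : 'I_(ngauge T) -> C;                 (* cbar_a *)
  pd_der : forall mu, superderivation G (0, 0) (pd mu);
  pd_comm : forall mu nu x, pd mu (pd nu x) = pd nu (pd mu x);
  fh_deg : forall mu nu, bihom G (0, 0) (fh mu nu);
  fginv_deg : forall mu nu, bihom G (0, 0) (fginv mu nu);
  fe_deg : forall a mu, bihom G (0, 0) (fe a mu);
  feinv_deg : forall a mu, bihom G (0, 0) (feinv a mu);
  fA_deg : forall a mu, bihom G (0, 0) (fA a mu);
  fPhi_deg : forall i, bihom G (0, 0) (fPhi i);
  fPsi_deg : forall i, bihom G (0, 0) (fPsi i);
  fB_deg : forall rho, bihom G (0, 0) (fB rho);
  fb_deg : forall a, bihom G (0, 0) (fb a);
  fC_deg : forall rho, bihom G (1, 0) (fC rho);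
  fCbar_deg : forall rho, bihom G (-1, 0) (fCbar rho);
  fc_deg : forall a, bihom G (0, 1) (fc a);
  fcbar_deg : forall a, bihom G (0, -1) (fcbar a);
  fh_sym : forall mu nu, fh mu nu = fh nu mu;
  fginv_metric : forall mu nu, \sum_rho fginv mu rho
    * ((minkowski R[i] _ rho nu)%:A + (varkappa T)%:C *: fh rho nu)
    = (mu == nu)%:R;
  fe_metric : forall mu nu,
    \sum_a \sum_b minkowski R[i] _ a b *: (fe a mu * fe b nu)
    = (minkowski R[i] _ mu nu)%:A + (varkappa T)%:C *: fh mu nu;
  feinv_fe : forall a b, \sum_mu feinv a mu * fe b mu = (a == b)%:R;
  (* Every functional is a polynomial in the jets of the fields. *)
  fields_generate : forall X : C -> Prop,
    X 1 -> (forall (k : R[i]) x y, X x -> X y -> X (k *: x + y)) ->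
    (forall x y, X x -> X y -> X (x * y)) ->
    (forall mu x, X x -> X (pd mu x)) ->
    (forall mu nu, X (fh mu nu)) -> (forall mu nu, X (fginv mu nu)) ->
    (forall a mu, X (fe a mu)) -> (forall a mu, X (feinv a mu)) ->
    (forall a mu, X (fA a mu)) -> (forall i, X (fPhi i)) ->
    (forall i, X (fPsi i)) -> (forall rho, X (fB rho)) ->
    (forall a, X (fb a)) -> (forall rho, X (fC rho)) ->
    (forall rho, X (fCbar rho)) -> (forall a, X (fc a)) ->
    (forall a, X (fcbar a)) -> forall x, X x }.

Section Operators.
Variables (R : realType) (T : theory R) (C : algType R[i]).
Variables (G : superalgebra C) (F : particle_fields T G).

Let sp := 'I_(dim T).+1.
Let ga := 'I_(ngauge T).
Let eta := minkowski R[i] (dim T).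
Let kappa : R[i] := (varkappa T)%:C.
Let gc : R[i] := (gcoupling T)%:C.
Let ze : R[i] := (zeta T)%:C.
Let ix : R[i] := (xi T)%:C.
Let f (a b c : ga) : R[i] := (fstruct a b c)%:C.

Definition metric (mu nu : sp) : C := (eta mu nu)%:A + kappa *: fh F mu nu.

(* Gamma^rho_{mu nu} *)
Definition christoffel (rho mu nu : sp) : C :=
  2^-1 *: \sum_sigma fginv F rho sigma *
    (pd F mu (metric sigma nu) + pd F nu (metric sigma mu)
     - pd F sigma (metric mu nu)).

(* Lie derivatives along the vector field X^mu *)
Definition lie_scalar (X : sp -> C) (phi : C) : C :=
  \sum_sigma X sigma * pd F sigma phi.
Definition lie_covector (X w : sp -> C) (mu : sp) : C :=
  \sum_sigma (X sigma * pd F sigma (w mu) + pd F mu (X sigma) * w sigma).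
Definition lie_vector (X v : sp -> C) (rho : sp) : C :=
  \sum_sigma (X sigma * pd F sigma (v rho) - pd F sigma (X rho) * v sigma).

(* omega_{mu a b}, where omega_mu^a_b = e^a_nu nabla_mu e_b^nu *)
Definition spin_connection (mu a b : sp) : C :=
  \sum_c eta a c *: \sum_nu fe F c nu *
    (pd F mu (feinv F b nu)
     + \sum_lambda christoffel nu mu lambda * feinv F b lambda).

(* Sigma^{a b} = [gamma^a, gamma^b] / 4 *)
Definition spin_gen (a b : sp) : 'M[R[i]]_(nfermion T) :=
  4^-1 *: (gamma a *m gamma b - gamma b *m gamma a).

Definition apply_mx (n : nat) (M : 'M[R[i]]_n) (v : 'I_n -> C) (i : 'I_n) : C :=
  \sum_j M i j *: v j.

Definition nabla_spinor (psi : 'I_(nfermion T) -> C) (mu : sp)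
    (i : 'I_(nfermion T)) : C :=
  pd F mu (psi i)
  + 2^-1 *: \sum_a \sum_b
      spin_connection mu a b * apply_mx (spin_gen a b) psi i.

(* nabla_a X_b in the orthonormal frame *)
Definition nabla_frame (X : sp -> C) (a b : sp) : C :=
  \sum_mu \sum_nu feinv F a mu * feinv F b nu *
    \sum_lambda metric nu lambda *
      (pd F mu (X lambda) + \sum_sigma christoffel lambda mu sigma * X sigma).

(* Kosmann: L_X psi = X^mu nabla_mu psi + (1/8) nabla_a X_b [gamma^a, gamma^b]
   psi; the sign of the second term is the one belonging to the Clifford
   relation {gamma^a, gamma^b} = + 2 eta^{a b}. *)
Definition kosmann (X : sp -> C) (psi : 'I_(nfermion T) -> C)
    (i : 'I_(nfermion T)) : C :=
  (\sum_mu X mu * nabla_spinor psi mu i)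
  + 2^-1 *: \sum_a \sum_b
      nabla_frame X a b * apply_mx (spin_gen a b) psi i.

(* Spacetime indices are moved with the background metric eta when [full] is
   false and with the full metric g when it is true. *)
Section Index.
Variable full : bool.

Definition raise (v : sp -> C) (rho : sp) : C := \sum_sigma
  (if full then fginv F rho sigma else (eta rho sigma)%:A) * v sigma.
Definition lower (v : sp -> C) (rho : sp) : C := \sum_sigma
  (if full then metric rho sigma else (eta rho sigma)%:A) * v sigma.

(* The rules common to P (with X^rho = C^rho, Xlow_rho = C_rho) and Pbar (with
   X^rho = Cbar^rho, Xlow_rho = Cbar_rho). *)
Record diffeo_common (P : C -> C) (X Xlow : sp -> C) : Prop := DiffeoCommon {
  diffeo_pd : forall mu x, P (pd F mu x) = pd F mu (P x);
  diffeo_h : forall mu nu, P (fh F mu nu) =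
    ze^-1 *: pd F mu (Xlow nu) + ze^-1 *: pd F nu (Xlow mu)
    - 2 *: \sum_rho Xlow rho * christoffel rho mu nu;
  diffeo_e : forall a mu, P (fe F a mu) = kappa *: lie_covector X (fe F a) mu;
  diffeo_A : forall a mu, P (fA F a mu) = kappa *: lie_covector X (fA F a) mu;
  diffeo_Phi : forall i, P (fPhi F i) = kappa *: lie_scalar X (fPhi F i);
  diffeo_Psi : forall i, P (fPsi F i) = kappa *: kosmann X (fPsi F) i;
  diffeo_b : forall a, P (fb F a) = kappa *: lie_scalar X (fb F a);
  diffeo_c : forall a, P (fc F a) = kappa *: lie_scalar X (fc F a);
  diffeo_cbar : forall a, P (fcbar F a) = kappa *: lie_scalar X (fcbar F a) }.

Record diffeo_BRST (P : C -> C) : Prop := DiffeoBRST {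
  P_der : superderivation G (1, 0) P;
  P_common : diffeo_common P (raise (fC F)) (fC F);
  P_C : forall rho, P (fC F rho) =
    kappa *: \sum_sigma raise (fC F) sigma * pd F sigma (fC F rho);
  P_Cbar : forall rho, P (fCbar F rho) = ze^-1 *: fB F rho;
  P_B : forall rho, P (fB F rho) = 0 }.

Record diffeo_antiBRST (P : C -> C) : Prop := DiffeoAntiBRST {
  Pbar_der : superderivation G (-1, 0) P;
  Pbar_common : diffeo_common P (fCbar F) (lower (fCbar F));
  Pbar_C : forall rho, P (fC F rho) =
    - (ze^-1 *: lower (fB F) rho) + kappa *: lie_covector (fCbar F) (fC F) rho;
  Pbar_Cbar : forall rho, P (fCbar F rho) =
    kappa *: \sum_sigma fCbar F sigma * pd F sigma (fCbar F rho);
  Pbar_B : forall rho, P (fB F rho) = kappa *: lie_vector (fCbar F) (fB F) rho }.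

End Index.

(* The rules common to Q (with y = c) and Qbar (with y = cbar). *)
Record gauge_common (Q : C -> C) (y : ga -> C) : Prop := GaugeCommon {
  gauge_pd : forall mu x, Q (pd F mu x) = pd F mu (Q x);
  gauge_A : forall a mu, Q (fA F a mu) =
    ix^-1 *: pd F mu (y a) + gc *: \sum_b \sum_c f a b c *: (y b * fA F c mu);
  gauge_Phi : forall i, Q (fPhi F i) =
    gc *: \sum_a y a * apply_mx (higgs_rep a) (fPhi F) i;
  gauge_Psi : forall i, Q (fPsi F i) =
    gc *: \sum_a y a * apply_mx (fermion_rep a) (fPsi F) i;
  gauge_h : forall mu nu, Q (fh F mu nu) = 0;
  gauge_e : forall a mu, Q (fe F a mu) = 0;
  gauge_C : forall rho, Q (fC F rho) = 0;
  gauge_Cbar : forall rho, Q (fCbar F rho) = 0;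
  gauge_B : forall rho, Q (fB F rho) = 0 }.

(* Gauge indices are moved with delta_{ab}, hence not distinguished. *)
Record gauge_BRST (Q : C -> C) : Prop := GaugeBRST {
  Q_der : superderivation G (0, 1) Q;
  Q_common : gauge_common Q (fc F);
  Q_c : forall a, Q (fc F a) =
    (gc / 2) *: \sum_b \sum_c f a b c *: (fc F b * fc F c);
  Q_cbar : forall a, Q (fcbar F a) = ix^-1 *: fb F a;
  Q_b : forall a, Q (fb F a) = 0 }.

Record gauge_antiBRST (Q : C -> C) : Prop := GaugeAntiBRST {
  Qbar_der : superderivation G (0, -1) Q;
  Qbar_common : gauge_common Q (fcbar F);
  Qbar_c : forall a, Q (fc F a) =
    - (ix^-1 *: fb F a)
    + gc *: \sum_b \sum_c f a b c *: (fcbar F b * fc F c);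
  Qbar_cbar : forall a, Q (fcbar F a) =
    (gc / 2) *: \sum_b \sum_c f a b c *: (fcbar F b * fcbar F c);
  Qbar_b : forall a, Q (fb F a) =
    gc *: \sum_b \sum_c f a b c *: (fcbar F b * fb F c) }.

End Operators.

(** * The three (anti-)BRST operators *)

Inductive brst_kind : Type := Diffeo | Gauge | Total.

(* The degree respective to S. *)
Definition brst_degree (S : brst_kind) (p : bidegree) : int :=
  match S with Diffeo => p.1 | Gauge => p.2 | Total => total_degree p end.

Definition brst_operator (V : zmodType) (P Q : V -> V) (S : brst_kind) : V -> V :=
  match S with Diffeo => P | Gauge => Q | Total => fun x => P x + Q x end.

Definition square_zero (V : zmodType) (d : V -> V) : Prop :=
  forall x, d (d x) = 0.
Definition anticommute (V : zmodType) (d d' : V -> V) : Prop :=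
  forall x, d (d' x) + d' (d x) = 0.

(* With Stilde = sign_twist Sbar, anticommutation of S and Sbar makes S and
   Stilde commute, so that S Stilde + Stilde S = 2 (S Stilde): Stilde is a
   homotopy between 2 (S Stilde) and 0, and half of it one between S Stilde
   and 0. *)

(* Main.v *)
Require Import Defs.
From mathcomp Require Import all_boot all_order all_algebra.
From mathcomp Require Import reals complex.

Set Implicit Arguments.
Unset Strict Implicit.
Unset Printing Implicit Defensive.

Import Order.TTheory GRing.Theory Num.Theory.
Local Open Scope ring_scope.
Local Open Scope complex_scope.

(* On degree l, [Stilde S = (-1)^(l+1) Sbar S = (-1)^l S Sbar = S Stilde], so
   [S Stilde + Stilde S = 2 (S Stilde)].  All the identities between linear
   operators are checked on bihomogeneous elements, which span the algebra. *)

(** * Linearity of maps given as bare functions *)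

Section Linear.
Variables (K : nzRingType) (V : lmodType K).
Implicit Types f g : V -> V.

Lemma linear_map0 f : linear f -> f 0 = 0.
Proof.
move=> lf; have := lf (-1) 0 0.
by rewrite scaleN1r oppr0 addr0 scaleN1r addNr.
Qed.

Lemma linear_mapZ f : linear f -> forall a x, f (a *: x) = a *: f x.
Proof. by move=> lf a x; have := lf a x 0; rewrite (linear_map0 lf) !addr0. Qed.

Lemma linear_mapD f : linear f -> forall x y, f (x + y) = f x + f y.
Proof. by move=> lf x y; have := lf 1 x y; rewrite !scale1r. Qed.

Lemma linear_map_sum f (I : Type) (r : seq I) (E : I -> V) : linear f ->
  f (\sum_(i <- r) E i) = \sum_(i <- r) f (E i).
Proof. by move=> lf; rewrite (big_morph f (linear_mapD lf) (linear_map0 lf)). Qed.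

Lemma linear_add f g : linear f -> linear g -> linear (fun x => f x + g x).
Proof. by move=> lf lg a x y; rewrite lf lg scalerDr addrACA. Qed.

Lemma linear_comp f g : linear f -> linear g -> linear (fun x => f (g x)).
Proof. by move=> lf lg a x y; rewrite lg lf. Qed.

End Linear.

Lemma linear_scale (K : comNzRingType) (V : lmodType K) (k : K) (f : V -> V) :
  linear f -> linear (fun x => k *: f x).
Proof. by move=> lf a x y; rewrite lf scalerDr !scalerA mulrC. Qed.

(** * Homogeneous elements, graded maps and the sign twist *)

Section Graded.
Variables (K : fieldType) (C : algType K) (G : superalgebra C).
Variable deg : bidegree -> int.
Local Notation hom := (homog G deg).

(** Projecting the decomposition of [x] to bidegree [p] leaves only the summand indexed by [p]
    itself, which is absent. *)
Lemma component_notin_supp p x : p \notin supp G x -> component G p x = 0.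
Proof.
move=> npx; rewrite (component_sum G x) (linear_map_sum _ _ (component_linear G p)).
rewrite big_seq big1 // => q qx; rewrite component_component.
by case: eqP => // pq; rewrite pq qx in npx.
Qed.

Lemma bihom_component p x : bihom G p (component G p x).
Proof. by rewrite /bihom component_component eqxx. Qed.

Lemma eq_on_bihom (f g : C -> C) : linear f -> linear g ->
  (forall p x, bihom G p x -> f x = g x) -> f =1 g.
Proof.
move=> lf lg fg x; rewrite (component_sum G x) !linear_map_sum //.
by apply: eq_bigr => p _; apply/fg/bihom_component.
Qed.

Lemma bihom_homog p x : bihom G p x -> hom (deg p) x.
Proof.
move=> px q; rewrite -px component_component.
by case: (q =P p) => [-> // | _]; rewrite eqxx.
Qed.

Lemma homog0 l : hom l 0.
Proof. by move=> p; rewrite (linear_map0 (component_linear G p)) eqxx. Qed.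

Lemma homogD l x y : hom l x -> hom l y -> hom l (x + y).
Proof.
move=> hx hy p; rewrite (linear_mapD (component_linear G p)).
have [-> | /hx //] := eqVneq (component G p x) 0.
by rewrite add0r; apply: hy.
Qed.

Lemma homogZ l a x : hom l x -> hom l (a *: x).
Proof.
move=> hx p; rewrite (linear_mapZ (component_linear G p)).
by rewrite scaler_eq0 negb_or => /andP[_ /hx].
Qed.

Lemma graded_map_add k (f g : C -> C) : graded_map hom k f ->
  graded_map hom k g -> graded_map hom k (fun x => f x + g x).
Proof.
move=> [lf hf] [lg hg]; split; first exact: linear_add.
by move=> l x hx; apply: homogD; [apply: hf | apply: hg].
Qed.

Lemma graded_map_scale k a (f : C -> C) : graded_map hom k f ->
  graded_map hom k (fun x => a *: f x).
Proof.
move=> [lf hf]; split; first exact: linear_scale.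
by move=> l x hx; apply/homogZ/hf.
Qed.

Lemma graded_map_comp j k (f g : C -> C) : graded_map hom j f ->
  graded_map hom k g -> graded_map hom (k + j) (fun x => f (g x)).
Proof.
move=> [lf hf] [lg hg]; split; first exact: linear_comp.
by move=> l x hx; rewrite addrA; apply/hf/hg.
Qed.

Lemma graded_map0 k : graded_map hom k (fun=> 0).
Proof.
split=> [a x y | l x _]; last exact: homog0.
by rewrite scaler0 addr0.
Qed.

(** Additivity of [deg] turns the shift of bidegrees by [r] into a shift of degrees by [deg r]; the
    bihomogeneous components are treated one by one. *)
Lemma superderivation_graded r (d : C -> C) :
  (forall p, deg (p.1 + r.1, p.2 + r.2) = deg p + deg r) ->
  superderivation G r d -> graded_map hom (deg r) d.
Proof.
move=> degD [ld bd _]; split=> // l x hx.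
rewrite (component_sum G x) linear_map_sum //.
apply: (big_ind (hom (l + deg r))) => [||p _]; [exact: homog0 | exact: homogD |].
(* A vanishing component says nothing about [deg p], so only the nonzero ones can be placed in
   degree [l]. *)
have [-> | nz] := eqVneq (component G p x) 0.
  by rewrite (linear_map0 ld); apply: homog0.
by rewrite -(hx p nz) -degD; apply/bihom_homog/bd/bihom_component.
Qed.

(** The list [supp x] depends on [x], so twists of different elements are sums over different lists.
    Enlarging the list adds only zero terms, which makes such sums comparable. *)
Lemma sign_twist_widen (d : C -> C) (s : seq bidegree) x : linear d -> uniq s ->
  {subset supp G x <= s} ->
  sign_twist G deg d x = \sum_(p <- s) (-1) ^ deg p *: d (component G p x).
Proof.
move=> ld us xs; rewrite [RHS](bigID (mem (supp G x))) /= [X in _ + X]big1.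
  rewrite addr0 -[RHS]big_filter; apply/perm_big/uniq_perm.
  - exact: supp_uniq.
  - exact: filter_uniq.
  by move=> p; rewrite mem_filter; apply/idP/andP => [px | [] //]; rewrite px xs.
by move=> p /component_notin_supp->; rewrite (linear_map0 ld) scaler0.
Qed.

Lemma sign_twist_linear (d : C -> C) : linear d -> linear (sign_twist G deg d).
Proof.
move=> ld a x y.
(* One duplicate-free list that serves all three elements at once. *)
pose s := undup (supp G x ++ supp G y ++ supp G (a *: x + y)).
have us : uniq s by exact: undup_uniq.
rewrite !(@sign_twist_widen d s) //;
  try by move=> p; rewrite mem_undup !mem_cat => ->; rewrite ?orbT.
rewrite scaler_sumr -big_split; apply: eq_bigr => p _ /=.
by rewrite (component_linear G p) ld scalerDr !scalerA mulrC.
Qed.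

Lemma sign_twist_graded k (d : C -> C) : graded_map hom k d ->
  graded_map hom k (sign_twist G deg d).
Proof.
move=> [ld hd]; split; first exact: sign_twist_linear.
by move=> l x hx; rewrite (sign_twistE ld hx); apply/homogZ/hd.
Qed.

(** On each degree the square of the twist is the square of [d] up to a sign. *)
Lemma sign_twist_square_zero k (d : C -> C) : graded_map hom k d ->
  square_zero d -> square_zero (sign_twist G deg d).
Proof.
move=> gd dd; have [lt _] := sign_twist_graded gd; case: gd => ld hd.
apply: (eq_on_bihom (g := fun=> 0)); [exact: linear_comp | | move=> p x px].
  by case: (graded_map0 0).
have hx := bihom_homog px.
rewrite (sign_twistE ld hx) (linear_mapZ lt) (sign_twistE ld (hd _ _ hx)) dd.
by rewrite !scaler0.
Qed.

Lemma sign_twist_commute (S d : C -> C) : graded_map hom 1 S -> linear d ->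
  anticommute S d -> forall x, sign_twist G deg d (S x) = S (sign_twist G deg d x).
Proof.
move=> [lS hS] ld Sd; have lt := sign_twist_linear ld.
apply: eq_on_bihom; [exact: linear_comp | exact: linear_comp | move=> p x px].
have hx := bihom_homog px.
rewrite (sign_twistE ld (hS _ _ hx)) (sign_twistE ld hx) (linear_mapZ lS).
(* Anticommutation gives one sign and the degree shift by 1 of [S] gives another; they cancel.
   Splitting the integer power requires -1 to be nonzero. *)
rewrite -(addr0_eq (Sd x)) expfzDr ?oppr_eq0 ?oner_eq0 // expr1z mulrN1.
by rewrite scaleNr scalerN opprK.
Qed.

End Graded.

(** * Homotopies from operators that commute with the differential *)

(** Commutation turns [d h + h d] into [2 d h]. This is a map of complexes because both of its
    composites with [d] contain [d d = 0]. *)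
Lemma commuting_homotopy (K : fieldType) (C : algType K) (G : superalgebra C)
    (deg : bidegree -> int) k (d h f : C -> C) :
  let hom := homog G deg in
  graded_map hom k d -> graded_map hom (- k) h -> square_zero d ->
  (forall x, h (d x) = d (h x)) -> (forall x, f x = 2 *: d (h x)) ->
  is_homotopy hom k d h f (fun=> 0).
Proof.
move=> hom gd gh dd hd fE; have [ld _] := gd; split=> //.
- split=> [|x]; last by rewrite !fE hd (linear_mapZ ld) !dd.
  (* [f] is known only pointwise, so the grading is proved for the explicit composite, of degree
     [- k + k], and then transferred. *)
  have [lg hg] : graded_map hom 0 (fun x => 2 *: d (h x)).
    by rewrite -(addNr k); apply/graded_map_scale/graded_map_comp.
  by split=> [a x y | l x hx]; rewrite !fE; [exact: lg | exact: hg].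
- by split=> [|x]; [exact: graded_map0 | rewrite (linear_map0 ld)].
by move=> x; rewrite subr0 hd fE scaler_nat mulr2n.
Qed.

(** Halving [h] preserves commutation with [d] and absorbs the factor 2, which must be
    invertible. *)
Lemma commuting_null_homotopy (K : fieldType) (C : algType K)
    (G : superalgebra C) (deg : bidegree -> int) k (d h f : C -> C) :
  let hom := homog G deg in
  (2 : K) != 0 -> graded_map hom k d -> graded_map hom (- k) h ->
  square_zero d -> (forall x, h (d x) = d (h x)) -> (forall x, f x = d (h x)) ->
  is_homotopy hom k d (fun x => 2^-1 *: h x) f (fun=> 0).
Proof.
move=> hom nz2 gd gh dd hd fE; apply: commuting_homotopy => // [|x|x].
- exact: graded_map_scale.
- by rewrite hd (linear_mapZ gd.1).
by rewrite (linear_mapZ gd.1) scalerA divff // scale1r.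
Qed.

(** * Sums of operators, as needed for the total operators *)

Section TotalOperator.
Variable V : zmodType.

Lemma square_zero_add (d e : V -> V) : {morph d : x y / x + y} ->
  {morph e : x y / x + y} -> square_zero d -> square_zero e ->
  anticommute d e -> square_zero (fun x => d x + e x).
Proof. by move=> dD eD dd ee de x; rewrite dD eD dd ee add0r addr0. Qed.

(** The anticommutator is biadditive, so it splits into the four given ones. *)
Lemma anticommute_add (d e d' e' : V -> V) : {morph d : x y / x + y} ->
  {morph e : x y / x + y} -> {morph d' : x y / x + y} ->
  {morph e' : x y / x + y} -> anticommute d d' -> anticommute d e' ->
  anticommute e d' -> anticommute e e' ->
  anticommute (fun x => d x + e x) (fun x => d' x + e' x).
Proof.
move=> dD eD d'D e'D dd' de' ed' ee' x; rewrite dD eD d'D e'D.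
rewrite -(addr0_eq (dd' x)) -(addr0_eq (de' x)).
by rewrite -(addr0_eq (ed' x)) -(addr0_eq (ee' x)) -!opprD addrACA subrr.
Qed.

End TotalOperator.

(** Supplies the additivity that [superderivation_graded] asks of the degree, for all three gradings
    at once. *)
Lemma brst_degreeD (kind : brst_kind) (r p : bidegree) :
  brst_degree kind (p.1 + r.1, p.2 + r.2) = brst_degree kind p + brst_degree kind r.
Proof. by case: kind => //=; rewrite /total_degree /= addrACA. Qed.

Theorem proposition5p11 (R : realType) (T : theory R) (C : algType R[i])
    (G : superalgebra C) (F : particle_fields T G) (full : bool)
    (P Pbar Q Qbar : C -> C)
    (hP : diffeo_BRST F full P) (hPbar : diffeo_antiBRST F full Pbar)
    (hQ : gauge_BRST F Q) (hQbar : gauge_antiBRST F Qbar)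
    (PP : square_zero P) (PbarPbar : square_zero Pbar)
    (QQ : square_zero Q) (QbarQbar : square_zero Qbar)
    (PPbar : anticommute P Pbar) (QQbar : anticommute Q Qbar)
    (PQ : anticommute P Q) (PQbar : anticommute P Qbar)
    (PbarQ : anticommute Pbar Q) (PbarQbar : anticommute Pbar Qbar)
    (kind : brst_kind) :
  let hom := homog G (brst_degree kind) in
  let S := brst_operator P Q kind in
  let Sbar := brst_operator Pbar Qbar kind in
  let Stilde := sign_twist G (brst_degree kind) Sbar in
  let SStilde := S \o Stilde in
  [/\ cochain_homotopy hom S Stilde (fun x => 2 *: SStilde x) (fun=> 0),
      chain_homotopy hom Stilde S (fun x => 2 *: SStilde x) (fun=> 0),
      cochain_null_homotopic hom S SStilde
    & chain_null_homotopic hom Stilde SStilde].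
Proof.
move=> hom S Sbar Stilde SStilde.
have [[dP _ _ _ _] [dPb _ _ _ _]] := (hP, hPbar).
have [[dQ _ _ _ _] [dQb _ _ _ _]] := (hQ, hQbar).
have gP := superderivation_graded (brst_degreeD kind _) dP.
have gPb := superderivation_graded (brst_degreeD kind _) dPb.
have gQ := superderivation_graded (brst_degreeD kind _) dQ.
have gQb := superderivation_graded (brst_degreeD kind _) dQb.
have [aP aPb] := (linear_mapD gP.1, linear_mapD gPb.1).
have [aQ aQb] := (linear_mapD gQ.1, linear_mapD gQb.1).
(* The degrees of [P] and [Q] depend on [kind]: for instance [Q] has degree 0 for [Diffeo] but 1 for
   [Gauge] and [Total]. Each operator that occurs in [S] has degree 1. *)
have gS : graded_map hom 1 S.
  by rewrite /S /hom; move: gP gQ; case: (kind) => //=; apply: graded_map_add.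
have gSb : graded_map hom (- 1) Sbar.
  by rewrite /Sbar /hom; move: gPb gQb; case: (kind) => //=; apply: graded_map_add.
have SS : square_zero S.
  by rewrite /S; case: (kind) => //=; apply: square_zero_add.
have SbSb : square_zero Sbar.
  by rewrite /Sbar; case: (kind) => //=; apply: square_zero_add.
have SSb : anticommute S Sbar.
  rewrite /S /Sbar; case: (kind) => //=; apply: anticommute_add => // x.
  (* The remaining pair is [Q] with [Pbar], assumed in the opposite order. *)
  by rewrite addrC.
have gt : graded_map hom (- 1) Stilde := sign_twist_graded gSb.
have tt : square_zero Stilde := sign_twist_square_zero gSb SbSb.
have St x : Stilde (S x) = S (Stilde x) := sign_twist_commute gS gSb.1 SSb x.
have nz2 : (2 : R[i]) != 0 by rewrite pnatr_eq0.
split.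
- exact: commuting_homotopy.
(* The roles are exchanged: [Stilde] is the differential, of degree -1, and [S] the homotopy.
   Commutation identifies [S Stilde] with [Stilde S]. *)
- by apply: commuting_homotopy => // x; rewrite St.
(* The witness is half of the previous homotopy, since the map is now [SStilde] without the factor
   2. *)
- by exists (fun x => 2^-1 *: Stilde x); apply: commuting_null_homotopy.
- exists (fun x => 2^-1 *: S x).
  by apply: commuting_null_homotopy => // x; rewrite St.
Qed.
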